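(* Let $V$ be a real normed space of finite dimension $d\ge 1$, let $U$ be an abelian group with a translation-invariant ultrametric, let $\Lambda\subset V\times U$ be a closed additive subgroup, and let $X=(V\times U)/\Lambda$ carry the quotient metric induced by the maximum product metric. Let $\overline V=V/W$ be the reduced real factor. Then for every $\alpha\in X$ and every integer $N\ge 2$, $$g_N(\alpha)\le P(\overline V)+1.$$ If in addition $V$ is an inner-product space (its norm is induced by an inner product), then, with $E_\Lambda$ the effective real factor, for every $\alpha\in X$ and every $N\ge2$, $$g_N(\alpha)\le P(E_\Lambda)+1.$$
   Context: Metric setting. Write the ultrametric on $U$ as $d_U(u,w)=|u-w|_U$, so $|u+w|_U\le\max\{|u|_U,|w|_U\}$. On $V\times U$ put $|(v,u)|=\max\{\|v\|_V,|u|_U\}$; ''closed'' refers to the induced metric topology. On $X=(V\times U)/\Lambda$ put $\|a+\Lambda\|_X=\inf_{\lambda\in\Lambda}|a-\lambda|$ and $d_X(x,y)=\|x-y\|_X$ (a metric because $\Lambda$ is closed). Neither compactness of $X$ nor discreteness of $\Lambda$ is assumed. Nearest-neighbour distances. For $\alpha\in X$ and $N\ge2$ let $\mathcal O_N(\alpha)=\{0,\alpha,\dots,(N-1)\alpha\}$ as a set (repetitions discarded). If it has at least two points put $\delta_N(x)=\min_{y\in\mathcal O_N(\alpha),\,y\ne x}d_X(x,y)$ and $g_N(\alpha)=\#\{\delta_N(x):x\in\mathcal O_N(\alpha)\}$; if it is a singleton, $g_N(\alpha)=0$. Packing number. For a finite-dimensional real normed space $Y$, $P(Y)$ is the maximal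 cardinality of a set $S\subset\{v\in Y:\|v\|_Y<1\}$ (open unit ball) with $\|v-w\|_Y\ge1$ for all distinct $v,w\in S$. This maximum is finite, and $P(\{0\})=1$. Reduced real factor. $W=\{v\in V:(tv,0)\in\Lambda\text{ for every }t\in\mathbb R\}$, a linear subspace of $V$; $\overline V=V/W$ with the quotient norm. Effective real factor (when $V$ is an inner-product space). Let $\pi:V\to W^\perp$ be orthogonal projection. Then $E_\Lambda=\operatorname{span}_{\mathbb R}\{\pi(v):(v,u)\in\Lambda\}\subset W^\perp$, with the induced inner product and norm. *)

(* Defs.v *)
From HB Require Import structures.
From mathcomp Require Import all_boot all_order all_algebra.
From mathcomp Require Import all_classical all_reals all_analysis.

Set Implicit Arguments.
Unset Strict Implicit.
Unset Printing Implicit Defensive.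

Import Order.TTheory GRing.Theory Num.Theory.
Import numFieldNormedType.Exports.
Import Quotient.

Local Open Scope classical_set_scope.
Local Open Scope ring_scope.

#[short(type="finNormedModType")]
HB.structure Definition FinNormedModule (R : realType) :=
  {V of NormedModule R V & Vector R V}.

HB.mixin Record isUltrametricZmodule (R : realType) U & GRing.Zmodule U := {
  udist : U -> U -> R ;
  udistxx : forall u, udist u u = 0 ;
  udist_positivity : forall u v, udist u v = 0 -> u = v ;
  udist_sym : forall u v, udist u v = udist v u ;
  udist_max : forall v u w, udist u w <= Num.max (udist u v) (udist v w) ;
  udistDr : forall w u v, udist (u + w) (v + w) = udist u v
}.

(* Not a normed Z-module: the norms of the library satisfy
   |x *+ n| = |x| *+ n, which fails for nontrivial ultrametric norms. *)
#[short(type="ultrametricZmodType")]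
HB.structure Definition UltrametricZmodule (R : realType) :=
  {U of GRing.Zmodule U & isUltrametricZmodule R U}.

Section ProductMetric.
Variables (R : realType) (V : finNormedModType R) (U : ultrametricZmodType R).

Definition unorm (u : U) : R := udist u 0.

Lemma unormB (u v : U) : unorm (u - v) = udist u v.
Proof. by rewrite /unorm -(udistDr v) subrK add0r. Qed.

Lemma unorm_ge0 (u : U) : 0 <= unorm u.
Proof.
have := udist_max (0 : U) u u.
by rewrite udistxx (udist_sym 0) maxxx.
Qed.

Definition prod_norm (a : V * U) : R := Num.max `|a.1| (unorm a.2).

Definition prod_dist (a b : V * U) : R := prod_norm (a - b).

Lemma prod_distxx (a : V * U) : prod_dist a a = 0.
Proof. by rewrite /prod_dist subrr /prod_norm /= normr0 /unorm udistxx maxxx. Qed.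

Lemma prod_dist_positivity a b : prod_dist a b = 0 -> a = b.
Proof.
case: a b => [a1 a2] [b1 b2]; rewrite /prod_dist /prod_norm /= => ab0.
have /andP[a1b1 a2b2] : (`|a1 - b1| <= 0) && (unorm (a2 - b2) <= 0).
  by rewrite -ge_max ab0.
have /eqP -> : a1 == b1 by rewrite -subr_eq0 -normr_le0.
suff -> : a2 = b2 by [].
apply: udist_positivity; rewrite -unormB.
by apply/eqP; rewrite eq_le a2b2 unorm_ge0.
Qed.

Lemma prod_dist_sym a b : prod_dist a b = prod_dist b a.
Proof. by rewrite /prod_dist /prod_norm /= distrC !unormB udist_sym. Qed.

Lemma prod_dist_triangle b a c :
  prod_dist a c <= prod_dist a b + prod_dist b c.
Proof.
rewrite /prod_dist /prod_norm /= !unormB ge_max; apply/andP; split.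
  apply: (le_trans (ler_distD b.1 _ _)).
  by apply: lerD; rewrite le_max lexx.
apply: (le_trans (udist_max b.2 _ _)).
have h (u v : U) : 0 <= udist u v by rewrite -unormB unorm_ge0.
rewrite ge_max; apply/andP; split.
  by rewrite ler_wpDr ?le_max ?lexx ?orbT// h orbT.
by rewrite ler_wpDl ?le_max ?lexx ?orbT// h orbT.
Qed.

(* V * U with the metric topology of prod_dist. *)
Definition prod_space : Type := (V * U)%type.

HB.instance Definition _ := Choice.on prod_space.
HB.instance Definition _ := @isMetric.Build R prod_space prod_dist
  prod_distxx prod_dist_positivity prod_dist_sym prod_dist_triangle.

End ProductMetric.

(* The infimum does not depend on the representative of x. *)
Definition quot_norm (R : realType) (G : zmodType) (nrm : G -> R)
    (H : zmodClosed G) (x : {quot H}) : R :=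
  inf [set nrm (repr x - h) | h in [set h | h \in H]].

Definition quot_dist (R : realType) (V : finNormedModType R)
    (U : ultrametricZmodType R) (L : zmodClosed (V * U)%type)
    (x y : {quot L}) : R :=
  quot_norm (@prod_norm R V U) (x - y).

Section NearestNeighbours.
Variables (R : realType) (X : zmodType) (dist : X -> X -> R).

Definition initial_orbit (alpha : X) (N : nat) : seq X :=
  undup [seq alpha *+ k | k <- iota 0 N].

(* The set is finite, and nonempty when the orbit has two points, so that the
   infimum is a minimum. *)
Definition nn_dist (alpha : X) (N : nat) (x : X) : R :=
  inf [set dist x y | y in [set y | y \in initial_orbit alpha N /\ y != x]].

Definition nn_count (alpha : X) (N : nat) : nat :=
  if (2 <= size (initial_orbit alpha N))%N
  then size (undup [seq nn_dist alpha N x | x <- initial_orbit alpha N])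
  else 0%N.

End NearestNeighbours.

Section Packing.
Variables (R : realType) (Y : zmodType) (nrm : Y -> R).

Definition is_packing (E S : set Y) : Prop :=
  (forall v, S v -> E v /\ nrm v < 1) /\
  (forall v w, S v -> S w -> v <> w -> 1 <= nrm (v - w)).

(* Packing number of the subspace E of Y with the induced norm.  The
   maximum is over all packings, finite or not; it exists when E is a
   finite-dimensional normed subspace, so that the default 0 is not reached. *)
Definition packing_number (E : set Y) : nat :=
  xget 0%N [set n | (exists S, is_packing E S /\ (S #= `I_n)%card) /\
                    (forall S, is_packing E S -> (S #<= `I_n)%card)].

End Packing.

Section Factors.
Variables (R : realType) (V : finNormedModType R) (U : ultrametricZmodType R).
Variable L : zmodClosed (V * U)%type.

(* The subspace W = {v | R v * {0} is contained in L}. *)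
Definition flat_part : {pred V} :=
  fun v => `[< forall t : R, (t *: v, 0 : U) \in L >].

Lemma flat_partP (v : V) :
  reflect (forall t : R, (t *: v, 0 : U) \in L) (v \in flat_part).
Proof. exact: asboolP. Qed.

Lemma flat_part_submod_closed : submod_closed flat_part.
Proof.
split=> [|a u v /flat_partP uL /flat_partP vL]; apply/flat_partP => t.
  by rewrite scaler0; exact: rpred0.
have -> : (t *: (a *: u + v), 0 : U) = (t * a *: u, 0) + (t *: v, 0).
  by congr (_, _); rewrite /= ?addr0// scalerDr scalerA.
exact: rpredD.
Qed.

HB.instance Definition _ :=
  GRing.isSubmodClosed.Build R V flat_part flat_part_submod_closed.

Definition reduced_real_factor : zmodType := {quot flat_part}.

Definition reduced_norm (x : reduced_real_factor) : R :=
  quot_norm (fun v : V => `|v|) (x : {quot flat_part}).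

(* p is in the orthogonal of W and v - p is in W; such a p exists and is unique
   as V is finite-dimensional. *)
Definition is_orth_proj (ip : {dot V for idfun}) (v p : V) : Prop :=
  (forall w, w \in flat_part -> ip p w = 0) /\ v - p \in flat_part.

Definition orth_proj (ip : {dot V for idfun}) (v : V) : V :=
  xget 0 [set p | is_orth_proj ip v p].

Definition linear_span (A : set V) : set V :=
  [set v | exists s : seq V, (forall x, x \in s -> A x) /\ v \in span s].

Definition effective_real_factor (ip : {dot V for idfun}) : set V :=
  linear_span [set orth_proj ip a.1 | a in [set a : V * U | a \in L]].

End Factors.

(* Main.v *)
Require Import Defs.
From HB Require Import structures.
From mathcomp Require Import all_boot all_order all_algebra.
From mathcomp Require Import finmap zify.
From mathcomp Require Import all_classical all_reals all_analysis.

Set Implicit Arguments.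
Unset Strict Implicit.
Unset Printing Implicit Defensive.

Import Order.TTheory GRing.Theory Num.Theory.
Import numFieldNormedType.Exports.
Import Quotient.

Local Open Scope quotient_scope.
Local Open Scope classical_set_scope.
Local Open Scope ring_scope.

(* The nearest-neighbour distance of k alpha is the minimum of ||m alpha|| over
   1 <= m <= max(k, N-1-k) with m alpha <> 0.  Hence g_N - 1 is at most the
   number of record times m in (N/2, N), at which ||m alpha|| drops below all
   earlier values.  Let delta be the minimum over m <= N/2.  At record times
   ||m alpha|| < delta, while a difference of two record times is less than N/2,
   so that ||(m - m') alpha|| >= delta.  Lift m alpha to (v_m, u_m) of norm
   < delta: by the ultrametric inequality |u_m - u_m'| < delta, so
   ||v_m - v_m'|| >= delta, even modulo W, and the v_m / delta form a packing
   of V/W.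
   In the Euclidean case decompose the projection to W^perp of a fixed lift of
   alpha as e + f, with e in E and f orthogonal to E.  The f-components of the
   projections of v_m are m f, and |m - m'| <= N/2 < m for record times, so by
   Pythagoras the E-components have norm < eta and are eta-separated, where
   eta^2 = delta^2 - (N/2)^2 |f|^2. *)

(** * Finiteness of packings in finite dimension, and the packing number *)

Section Compactness.
Import VectorInternalTheory.

(** Norm equivalence: on the compact unit sphere of coordinates the continuous map |phi x| has a
    positive minimum c, so the unit ball of V lies in the image under [phi] of the compact ball of
    radius 1/c. *)
Lemma finite_dim_ball_covered (R : realType) (V : finNormedModType R) :
  exists K : set V, compact K /\ forall v : V, `|v| < 1 -> K v.
Proof.
pose phi : {linear 'rV[R]_(dim V) -> V} := @r2v R V.
pose C := \sum_(i < dim V) `|phi (delta_mx 0 i)|.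
have C0 : 0 <= C by apply: sumr_ge0.
have phiC x : `|phi x| <= C * `|x|.
  rewrite {1}(row_sum_delta x) linear_sum /= (le_trans (ler_norm_sum _ _ _))//.
  rewrite /C mulr_suml; apply: ler_sum => i _.
  rewrite linearZ /= normrZ mulrC ler_wpM2l//.
  rewrite [leRHS]/Num.norm /= mx_normrE; apply/bigmax_geP; right => /=.
  by exists (0, i).
have cphi : continuous phi.
  apply: bounded_linear_continuous.
  exists C; split; first exact: num_real.
  move=> M CM. 
  rewrite /= -nbhs_nbhs_norm; exists 1 => //= x /=.
  rewrite sub0r normrN => /ltW x1.
  apply: (le_trans (phiC x)).
  by rewrite (le_trans _ (ltW CM))// ler_piMr.
pose S := [set x : 'rV[R]_(dim V) | `|x| = 1].
have cS : compact S.
  apply: bounded_closed_compact.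
    exists 1; split; first exact: num_real.
    by move=> M M1 x /= ->; exact: ltW.
  apply: (@closed_comp _ _ (fun x : 'rV[R]_(dim V) => `|x|) [set 1]).
    by move=> x _; exact: norm_continuous.
  exact: closed_eq.
have [c c0 cP] : exists2 c, 0 < c & forall x, c * `|x| <= `|phi x|.
  (* An empty sphere means that 0 is the only coordinate vector, and then any positive c serves. *)
  have [[x0 Sx0]|S0] := pselect (S !=set0); last first.
    exists 1 => // x; rewrite mul1r.
    have [->|x0] := eqVneq x 0; first by rewrite normr0.
    exfalso; apply: S0; exists (`|x|^-1 *: x).
    rewrite /S /= normrZ normfV normr_id mulVf// normr_eq0 //.
  have [|m mS mP] :=
    @compact_EVT_min _ R (fun x => `|phi x|) S (ex_intro _ x0 Sx0) cS.
    apply: continuous_subspaceT => x.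
    by apply: continuous_comp; [exact: cphi|exact: norm_continuous].
  rewrite inE in mS.
  exists `|phi m|.
    rewrite normr_gt0; apply/eqP => pm0.
    have m0 : m = 0 by apply: (@r2v_inj R V); rewrite -/(phi m) pm0 linear0.
    by move: mS; rewrite /S /= m0 normr0 => /eqP; rewrite eq_sym oner_eq0.
  move=> x; have [->|x1] := eqVneq x 0; first by rewrite !normr0 mulr0.
  have nx0 : 0 < `|x| by rewrite normr_gt0.
  rewrite -ler_pdivlMr//.
  have := mP (`|x|^-1 *: x).
  rewrite linearZ /= normrZ normfV normr_id mulrC; apply; rewrite inE /S /=.
  by rewrite normrZ normfV normr_id mulVf// gt_eqF.
exists (phi @` [set x : 'rV[R]_(dim V) | `|x| <= c^-1]); split.
  apply: continuous_compact; first exact: continuous_subspaceT.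
  apply: bounded_closed_compact.
    exists c^-1; split; first exact: num_real.
    by move=> M M1 x /= h; apply: le_trans h (ltW M1).
  apply: (@closed_comp _ _ (fun x : 'rV[R]_(dim V) => `|x|)
    [set y | y <= c^-1]).
    by move=> x _; exact: norm_continuous.
  exact: closed_le.
move=> v v1; exists (v2r v); last exact: v2rK.
have /= := cP (v2r v).
rewrite v2rK => h; rewrite -[leRHS]mul1r ler_pdivlMr// mulrC.
exact: le_trans h (ltW v1).
Qed.

End Compactness.

(** Finitely many balls of radius 1/2 cover the unit ball, and two points sharing one of them are at
    distance less than 1; so sending a point of S to the centre of such a ball is injective. *)
Lemma separated_unit_ball_card (R : realType) (V : finNormedModType R) :
  exists n, forall S : set V, (forall v, S v -> `|v| < 1) ->
    (forall v w, S v -> S w -> v <> w -> 1 <= `|v - w|) -> (S #<= `I_n)%card.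
Proof.
have [K [cK KP]] := finite_dim_ball_covered V.
move: cK; rewrite compact_cover => /(_ V setT (fun v => ball v 2^-1)).
case=> [v _|v _|D _ KD]; first exact: ball_open.
  by exists v => //; exact: ballxx.
have [n /card_eqPle[Dn _]] := (finite_setP [set` D]).1 (finite_fset D).
exists n => S S1 Ssep; apply: card_le_trans Dn.
have Sc v : exists i, S v -> i \in D /\ ball i 2^-1 v.
  have [Sv|nSv] := pselect (S v); last by exists 0.
  by have [i iD iv] := KD v (KP v (S1 v Sv)); exists i.
have [c cP] := choice Sc.
have inj_c : {in S &, injective c}.
  move=> v w /set_mem Sv /set_mem Sw cvw; apply: contrapT => vw.
  have := Ssep v w Sv Sw vw; apply/negP; rewrite -ltNge.
  have [_ bv] := cP v Sv; have [_ bw] := cP w Sw.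
  rewrite -cvw in bw; rewrite (splitr 1) !div1r.
  have := ball_triangle (ball_sym bv) bw.
  by rewrite -ball_normE.
rewrite -(card_le_eql (inj_card_eq inj_c)).
apply: subset_card_le => _ [v Sv <-] /=.
by have [] := cP v Sv.
Qed.

(** A uniform bound n on packings yields a largest cardinality among them, so the [xget] in
    [packing_number] returns this maximum rather than its default. *)
Lemma card_le_packing_number (R : realType) (Y : zmodType) (nrm : Y -> R)
    (E S : set Y) n :
  (forall T, is_packing nrm E T -> (T #<= `I_n)%card) ->
  is_packing nrm E S -> (S #<= `I_(packing_number nrm E))%card.
Proof.
move=> Pn PS.
pose p k := `[< exists T, is_packing nrm E T /\ (T #= `I_k)%card >].
have p_le k : p k -> (k <= n)%N.
  move=> /asboolP[T [PT Tk]]; rewrite -card_le_II.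
  by rewrite -(card_le_eql Tk); exact: Pn.
have exp : exists k, p k.
  have /finite_setP[k Sk] : finite_set S.
    by apply/finite_set_leP; exists n; exact: Pn.
  by exists k; apply/asboolP; exists S.
have [k /asboolP pk kmax] := ex_maxnP exp p_le.
apply: (@xgetPex _ 0%N 
  [set n | (exists S, is_packing nrm E S /\ (S #= `I_n)%card) /\
           (forall S, is_packing nrm E S -> (S #<= `I_n)%card)] _).2 PS.
exists k; split=> // T PT.
have /finite_setP[j Tj] : finite_set T.
  by apply/finite_set_leP; exists n; exact: Pn.
by rewrite (card_le_eql Tj) card_le_II; apply: kmax; apply/asboolP; exists T.
Qed.

(** Two indices with equal values would give 1 <= [nrm 0]; so [nrm 0 < 1] makes [y] injective on
    [s], and its image is a packing with [size s] points. *)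
Lemma size_le_packing_number (R : realType) (Y : zmodType) (nrm : Y -> R)
    (E : set Y) (I : eqType) (s : seq I) (y : I -> Y) n :
  (forall T, is_packing nrm E T -> (T #<= `I_n)%card) ->
  nrm 0 < 1 -> uniq s ->
  (forall i, i \in s -> E (y i) /\ nrm (y i) < 1) ->
  (forall i j, i \in s -> j \in s -> i != j -> 1 <= nrm (y i - y j)) ->
  (size s <= packing_number nrm E)%N.
Proof.
move=> Pn nrm0 s_uniq y1 ysep.
have inj_y : {in s &, injective y}.
  move=> i j si sj yij; apply/eqP/negPn/negP => /(ysep _ _ si sj).
  by rewrite yij subrr leNgt nrm0.
have : is_packing nrm E (y @` [set` s]).
  split=> [_ [i si <-]|_ _ [i si <-] [j sj <-] yij]; first exact: y1.
  by apply: ysep => //; apply/eqP => ij; apply: yij; rewrite ij.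
move=> /(card_le_packing_number Pn).
have ys : {in [set` s] &, injective y}.
  by move=> i j /set_mem ? /set_mem ?; exact: inj_y.
rewrite (card_le_eql (inj_card_eq ys)) -card_le_II.
case: s s_uniq {y1 ysep inj_y ys} => [_ _|i0 s s_uniq].
  by rewrite card_le_II.
apply: card_le_trans.
have inj_nth : {in `I_(size (i0 :: s)) &, injective (nth i0 (i0 :: s))}.
  by move=> i j /set_mem si /set_mem sj /eqP; rewrite nth_uniq// => /eqP.
rewrite -(card_le_eql (inj_card_eq inj_nth)).
by apply: subset_card_le => _ [i si <-]; exact: mem_nth.
Qed.

(** * Nearest-neighbour distances along the orbit and record times *)

Lemma size_undup_iota_le (T : eqType) (F : nat -> T) (m n : nat) :
  (size (undup [seq F t | t <- iota m n.+1])
     <= (count (fun t => F t.+1 != F t) (iota m n)).+1)%N.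
Proof.
elim: n m => [|n IHn] m //.
rewrite [iota m n.+2]/= [map _ _]/= [undup _]/= -/(iota m.+1 n.+1) -/(map F _).
have /= IH := IHn m.+1.
(* If the head equals the next term, [undup] drops it; otherwise the change is counted at m. *)
have [Fm|Fm] := eqVneq (F m.+1) (F m); last by case: ifP => _ /=; lia.
by rewrite -{1}Fm mem_head.
Qed.

Lemma inf_eq_min (R : realType) (A : set R) (a : R) :
  A a -> lbound A a -> inf A = a.
Proof.
move=> Aa lbA; apply/eqP; rewrite eq_le; apply/andP; split.
  by apply: ge_inf => //; exists a.
by apply: lb_le_inf => //; exists a.
Qed.

Section NearestNeighbourCount.
Variables (R : realType) (X : zmodType) (nrm : X -> R).
Hypothesis nrmN : forall x, nrm (- x) = nrm x.
Variable alpha : X.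

(* The placeholder at t = 0 is the term m = 1, so it is harmless for t >= 1. *)
Fixpoint multiples_min (t : nat) : R :=
  if t is t'.+1 then
    if alpha *+ t != 0 then Num.min (multiples_min t') (nrm (alpha *+ t))
    else multiples_min t'
  else nrm alpha.

Lemma multiples_min_nincr s t : (s <= t)%N ->
  multiples_min t <= multiples_min s.
Proof.
elim: t => [|t IHt]; first by rewrite leqn0 => /eqP->.
rewrite leq_eqVlt => /predU1P[->//|]; rewrite ltnS => /IHt.
apply: le_trans => /=.
by case: ifP; rewrite // ge_min lexx.
Qed.

Lemma multiples_min_le m t :
  (0 < m <= t)%N -> alpha *+ m != 0 -> multiples_min t <= nrm (alpha *+ m).
Proof.
case: m => // m /= mt m0; apply: le_trans (multiples_min_nincr mt) _.
by rewrite [leLHS]/= m0 ge_min lexx orbT.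
Qed.

Lemma multiples_min_attained t : alpha != 0 -> (0 < t)%N ->
  exists m, [/\ (0 < m <= t)%N, alpha *+ m != 0
              & multiples_min t = nrm (alpha *+ m)].
Proof.
move=> alpha0; elim: t => // -[_ _|t IHt _].
  by exists 1%N; rewrite /= mulr1n alpha0 minxx.
have [//|m [/andP[m0 mt] ma mE]] := IHt.
have m_ok : exists m0, [/\ (0 < m0 <= t.+2)%N, alpha *+ m0 != 0
              & multiples_min t.+1 = nrm (alpha *+ m0)].
  by exists m; rewrite m0 ltnW.
rewrite [multiples_min _]/= -/(multiples_min t.+1).
case: ifP => // t0; rewrite /Num.min; case: ifP => // _.
by exists t.+2; rewrite leqnn.
Qed.

Lemma multiples_min_step t : multiples_min t.+1 != multiples_min t ->
  [/\ alpha *+ t.+1 != 0, multiples_min t.+1 = nrm (alpha *+ t.+1)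
    & nrm (alpha *+ t.+1) < multiples_min t].
Proof.
rewrite [multiples_min _.+1]/=; have [t0|_] := ifPn; last by rewrite eqxx.
have [_|lt_t] := leP (multiples_min t); first by rewrite eqxx.
by split.
Qed.

Let dist x y := nrm (x - y).

(** Only the size of the offset from k matters. Backward offsets reach k and forward ones N - 1 - k,
    so together they realise all m up to the larger of the two. *)
Lemma nn_dist_multiple (N k : nat) : (1 < N)%N -> alpha != 0 -> (k < N)%N ->
  nn_dist dist alpha N (alpha *+ k) = multiples_min (maxn k (N.-1 - k)).
Proof.
move=> N1 alpha0 kN.
have mem_orbit j : (j < N)%N -> alpha *+ j \in initial_orbit alpha N.
  by move=> jN; rewrite mem_undup; apply: map_f; rewrite mem_iota.
apply: inf_eq_min.
  have [|m [/andP[m0 mt] ma ->]] :=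
      multiples_min_attained (t := maxn k (N.-1 - k)) alpha0.
    by lia.
  (* A minimising offset m is taken backward if m <= k; otherwise m <= N - 1 - k and it is taken
     forward. *)
  have [mk|km] := leqP m k.
    exists (alpha *+ (k - m)).
      split; first by apply: mem_orbit; lia.
      by rewrite mulrnBr// -subr_eq0 addrAC subrr add0r oppr_eq0.
    by rewrite /dist mulrnBr// opprB addrC subrK.
  exists (alpha *+ (k + m)).
    split; first by apply: mem_orbit; lia.
    by rewrite mulrnDr -subr_eq0 addrAC subrr add0r.
  by rewrite /dist mulrnDr opprD addrA subrr add0r nrmN.
move=> _ [_ [] /[!mem_undup] /mapP[j jN ->] /eqP jk <-].
move: jN; rewrite mem_iota add0n => /andP[_ jN].
have [kj|jk'] := leqP k j.
  rewrite /dist -nrmN opprB -mulrnBr//; apply: multiples_min_le.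
    suff: k <> j by lia.
    by move=> kj'; apply: jk; rewrite kj'.
  by rewrite mulrnBr// subr_eq0; apply/eqP.
rewrite /dist -mulrnBr 1?ltnW//; apply: multiples_min_le; first by lia.
by rewrite mulrnBr 1?ltnW// subr_eq0 eq_sym; apply/eqP.
Qed.

(* The witnesses are the times m > N/2 at which nrm (m alpha) is smaller than at
   all earlier nonzero multiples, and the minimum delta over m <= N/2; a
   difference of two such times is at most N/2. *)
Lemma nn_count_le_records (N : nat) : (1 < N)%N ->
  exists (s : seq nat) (delta : R),
    [/\ uniq s, (nn_count dist alpha N <= (size s).+1)%N,
        forall m, m \in s -> (N./2 < m < N)%N /\ nrm (alpha *+ m) < delta
      & forall m m', m \in s -> m' \in s -> (m' < m)%N ->
          delta <= nrm (alpha *+ (m - m'))].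
Proof.
move=> N1; have [alpha0|alpha0] := eqVneq alpha 0.
  exists [::], 0; split=> //; rewrite /nn_count; case: ifP => // _.
  have: {subset initial_orbit alpha N <= [:: 0]}.
    move=> x; rewrite mem_undup => /mapP[k _ ->].
    by rewrite alpha0 mul0rn mem_head.
  move=> /(uniq_leq_size (undup_uniq _)) /= h.
  by apply: leq_trans (size_undup _) _; rewrite size_map.
(* For k < N the index [maxn k (N.-1 - k)] lies in [M, N - 1], a range of N - M = [n.+1]
   integers. *)
pose M := N./2; pose n := (N - M).-1.
have nE : (N - M)%N = n.+1 by rewrite /n /M; lia.
pose recs := [seq t <- iota M n | multiples_min t.+1 != multiples_min t].
have recsP t : t \in recs ->
    (M <= t < N.-1)%N /\ multiples_min t.+1 != multiples_min t.
  by rewrite mem_filter mem_iota => /andP[-> /andP[Mt tn]]; split => //; lia.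
exists [seq t.+1 | t <- recs], (multiples_min M); split.
- by rewrite map_inj_uniq ?filter_uniq ?iota_uniq//; exact: succn_inj.
- rewrite /nn_count; case: ifP => // _; rewrite size_map size_filter.
  apply: leq_trans (size_undup_iota_le _ _ _).
  apply: uniq_leq_size (undup_uniq _) _ => v; rewrite !mem_undup.
  move=> /mapP[x /[!mem_undup] /mapP[k]].
  rewrite mem_iota add0n => /andP[_ kN] -> ->.
  rewrite nn_dist_multiple//; apply: map_f; rewrite mem_iota; rewrite /M; lia.
- move=> _ /mapP[t /recsP[tM] /multiples_min_step[_ _ t_lt] ->].
  split; first by rewrite -/M; lia.
  by apply: lt_le_trans t_lt _; apply: multiples_min_nincr; lia.
move=> m m' /mapP[t /recsP[tM] /multiples_min_step[_ _ t_lt] ->].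
move=> /mapP[s /recsP[sM] /multiples_min_step[_ s_eq _] ->]; rewrite ltnS => st.
apply: multiples_min_le; first by rewrite /M in tM sM *; lia.
(* If (t - s) alpha were 0, then (t + 1) alpha = (s + 1) alpha would have as norm the running
   minimum at s + 1, which is at least the one at t, so t + 1 would not be a record. *)
rewrite subSS; apply: contraTN t_lt => /eqP ts0.
rewrite -leNgt -(subnK (ltnW st)) -addnS mulrnDr ts0 add0r -s_eq.
by apply: multiples_min_nincr; lia.
Qed.

End NearestNeighbourCount.

(** * Quotient norms computed from arbitrary representatives *)

Section QuotientNorm.
Variables (R : realType) (G : zmodType) (nrm : G -> R) (H : zmodClosed G).
Hypothesis nrm_ge0 : forall a, 0 <= nrm a.
Local Notation pi := (\pi_({quot H})).

Let repr_pi a : repr (pi a) - a \in H.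
Proof. by rewrite idealrBE reprK. Qed.

Let has_lb_coset (x : {quot H}) :
  has_lbound [set nrm (repr x - h) | h in [set h | h \in H]].
Proof. by exists 0 => _ [h _ <-]. Qed.

(** Since [repr (pi a)] and a differ by an element of H, shifting h by it shows that the infimum
    runs over the same coset. *)
Lemma quot_norm_le a h : h \in H -> quot_norm nrm (pi a) <= nrm (a - h).
Proof.
move=> hH; apply: ge_inf => //; exists (repr (pi a) - a + h).
  exact: rpredD.
by rewrite opprD addrA subKr.
Qed.

Lemma quot_norm_ge c a : (forall h, h \in H -> c <= nrm (a - h)) ->
  c <= quot_norm nrm (pi a).
Proof.
move=> ca; apply: lb_le_inf.
  by exists (nrm (repr (pi a) - 0)); exists 0 => //; exact: rpred0.
move=> _ [h hH <-].
have -> : repr (pi a) - h = a - (h - (repr (pi a) - a)).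
  by rewrite opprB addrA addrCA subrr addr0.
by apply: ca; exact: rpredB.
Qed.

Lemma quot_norm_lt c a : quot_norm nrm (pi a) < c ->
  exists2 h, h \in H & nrm (a - h) < c.
Proof.
rewrite ltNge => ca; apply: contrapT => nex; move/negP: ca; apply.
apply: quot_norm_ge => h hH; rewrite leNgt; apply/negP => hc.
by apply: nex; exists h.
Qed.

Lemma quot_normN : (forall a, nrm (- a) = nrm a) ->
  forall x : {quot H}, quot_norm nrm (- x) = quot_norm nrm x.
Proof.
move=> nrmN.
have le_N (x : {quot H}) : quot_norm nrm (- x) <= quot_norm nrm x.
  rewrite -{2}[x]reprK; apply: quot_norm_ge => h hH.
  rewrite -{1}[x]reprK -raddfN -nrmN opprB addrC -[X in - _ + X]opprK.
  by apply: quot_norm_le; rewrite rpredN.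
by move=> x; apply/eqP; rewrite eq_le le_N -{1}[x]opprK le_N.
Qed.

End QuotientNorm.

(** * Short lifts of the record multiples to the product *)

Section RecordLifts.
Variables (R : realType) (V : finNormedModType R) (U : ultrametricZmodType R).
Variable L : zmodClosed (V * U)%type.

Lemma prod_norm_ge0 (a : V * U) : 0 <= prod_norm a.
Proof. by rewrite le_max normr_ge0. Qed.

Lemma prod_normN (a : V * U) : prod_norm (- a) = prod_norm a.
Proof.
by rewrite /prod_norm /= normrN -[- a.2]sub0r unormB udist_sym.
Qed.

(* The ultrametric factor of a difference of two short lifts is short, so the
   whole separation is realised in the real factor, even modulo W. *)
Lemma record_lifts (alpha : {quot L}) (N : nat) : (1 < N)%N ->
  exists (s : seq nat) (delta : R) (a : V * U) (lam : nat -> V * U),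
  [/\ uniq s, (nn_count (@quot_dist R V U L) alpha N <= (size s).+1)%N,
      forall m, m \in s -> [/\ (N./2 < m < N)%N, lam m \in L
                             & `|a.1 *+ m - (lam m).1| < delta]
    & forall m m' w, m \in s -> m' \in s -> (m' < m)%N -> w \in flat_part L ->
        delta <= `|(a.1 *+ m - (lam m).1) - (a.1 *+ m' - (lam m').1) - w|].
Proof.
move=> N1.
have nN := quot_normN (H := L) prod_norm_ge0 prod_normN.
have [s [delta [s_uniq s_size s_lt s_ge]]] := nn_count_le_records nN alpha N1.
(* One lift of alpha serves all m, so the lifts are [a *+ m] minus elements of L; the Euclidean case
   relies on this linear dependence on m. *)
pose a := repr alpha.
have aM m : alpha *+ m = \pi_({quot L}) (a *+ m) by rewrite raddfMn /= reprK.
have lam_ex m : exists h, m \in s -> h \in L /\ prod_norm (a *+ m - h) < delta.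
  have [ms|_] := boolP (m \in s); last by exists 0.
  have [_] := s_lt m ms; rewrite aM => /quot_norm_lt[h hL h_lt].
  by exists h.
have [lam lamP] := choice lam_ex.
have fstMn m : (a *+ m).1 = a.1 *+ m by exact: (raddfMn (@fst V U)).
exists s, delta, a, lam; split=> //.
  move=> m ms; have [lamL] := lamP m ms.
  rewrite gt_max /= fstMn => /andP[a_lt _].
  by have [mN _] := s_lt m ms.
move=> m m' w ms ms' lt_m wW.
have [lamL] := lamP m ms; rewrite gt_max /= fstMn => /andP[_ u_lt].
have [lamL'] := lamP m' ms'; rewrite gt_max /= fstMn => /andP[_ u_lt'].
(* Taking t = 1 in the definition of W, so subtracting (w, 0) does not change the class in X. *)
have w0L : (w, 0) \in L by have /flat_partP/(_ 1) := wW; rewrite scale1r.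
have hL : lam m - lam m' + (w, 0) \in L by rewrite rpredD// rpredB.
have := s_ge m m' ms ms' lt_m; rewrite aM.
move=> /le_trans/(_ (quot_norm_le prod_norm_ge0 _ hL)).
have -> : a *+ (m - m') - (lam m - lam m' + (w, 0)) =
    (a *+ m - lam m) - (a *+ m' - lam m') - (w, 0).
  by rewrite mulrnBr 1?ltnW// opprD addrA !opprD !opprK addrACA.
rewrite le_max => /orP[|]; first by rewrite /= !fstMn.
rewrite /= subr0 unormB leNgt => /negP[].
apply: le_lt_trans (udist_max 0 _ _) _.
by rewrite gt_max (udist_sym 0) u_lt.
Qed.

End RecordLifts.

Lemma quot_piB (G : zmodType) (H : zmodClosed G) (a b : G) :
  \pi_({quot H}) a - \pi_({quot H}) b = \pi_({quot H}) (a - b).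
Proof. by rewrite raddfB. Qed.

(** * The bound by the packing number of V/W *)

Section PackingBounds.
Variables (R : realType) (V : finNormedModType R) (U : ultrametricZmodType R).
Variable L : zmodClosed (V * U)%type.

Lemma subspace_packing_card : exists n, forall (E : set V) (S : set V),
  is_packing (fun v : V => `|v|) E S -> (S #<= `I_n)%card.
Proof.
have [n nP] := separated_unit_ball_card V.
by exists n => E S [S1 Ssep]; apply: nP => // v /S1[].
Qed.

(** Classes of norm below 1 lift to vectors of norm below 1, and the lifts stay separated because
    the projection to V/W does not increase norms; so the bound for V applies. *)
Lemma reduced_packing_card : exists n, forall S : set (reduced_real_factor L),
  is_packing (@reduced_norm R V U L) setT S -> (S #<= `I_n)%card.
Proof.
have [n nP] := separated_unit_ball_card V.
exists n => S [S1 Ssep].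
have lift_ex (x : reduced_real_factor L) : exists v : V,
    S x -> x = \pi_({quot (flat_part L)}) v /\ `|v| < 1.
  have [Sx|nSx] := pselect (S x); last by exists 0.
  have [_] := S1 x Sx.
  rewrite /reduced_norm -[x]reprK => /quot_norm_lt[w wW w_lt].
  exists (repr x - w) => _; split=> //.
  by apply/eqP; rewrite -idealrBE opprB addrC subrK.
have [l lP] := choice lift_ex.
have inj_l : {in S &, injective l}.
  move=> x y /set_mem Sx /set_mem Sy lxy.
  by have [-> _] := lP x Sx; rewrite lxy; have [<- _] := lP y Sy.
rewrite -(card_le_eql (inj_card_eq inj_l)).
apply: nP => [_ [x Sx <-]|_ _ [x Sx <-] [y Sy <-] lxy].
  by have [] := lP x Sx.
have xy : x <> y by move=> xy; apply: lxy; rewrite xy.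
apply: le_trans (Ssep x y Sx Sy xy) _.
have -> : x - y = \pi_({quot (flat_part L)}) (l x - l y).
  have [xE _] := lP x Sx; have [yE _] := lP y Sy.
  by rewrite -quot_piB -xE -yE.
rewrite -[X in `|X|]subr0; apply: quot_norm_le => //; exact: rpred0.
Qed.

Lemma nn_count_le_reduced (alpha : {quot L}) (N : nat) : (1 < N)%N ->
  (nn_count (@quot_dist R V U L) alpha N
     <= packing_number (@reduced_norm R V U L) setT + 1)%N.
Proof.
move=> N1; have [s [delta [a [lam [s_uniq s_size s_lt s_ge]]]]] :=
  record_lifts alpha N1.
rewrite addn1; apply: leq_trans s_size _; rewrite ltnS.
have [n nP] := reduced_packing_card.
(* [delta] exceeds a norm as soon as a record exists; for an empty [s] it may be 0. *)
have delta_gt0 m : m \in s -> 0 < delta.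
  by move=> /s_lt[_ _]; apply: le_lt_trans; exact: normr_ge0.
pose v m : V := a.1 *+ m - (lam m).1.
pose y m : reduced_real_factor L :=
  \pi_({quot (flat_part L)}) (delta^-1 *: v m).
have ysep i j : i \in s -> j \in s -> (j < i)%N ->
    1 <= reduced_norm (y i - y j).
  move=> si sj ij.
  have -> : y i - y j =
      \pi_({quot (flat_part L)}) (delta^-1 *: v i - delta^-1 *: v j).
    exact: quot_piB.
  (* W is a subspace, so after rescaling, w becomes delta w in W and [s_ge] applies. *)
  apply: quot_norm_ge => w wW.
  have d0 := delta_gt0 i si.
  have -> : delta^-1 *: v i - delta^-1 *: v j - w =
            delta^-1 *: (v i - v j - delta *: w).
    by rewrite !scalerBr scalerA mulVf ?gt_eqF// scale1r.
  rewrite normrZ gtr0_norm ?invr_gt0// mulrC ler_pdivlMr// mul1r.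
  by apply: s_ge => //; exact: rpredZ.
apply: (size_le_packing_number (y := y) nP) => //.
- rewrite /reduced_norm -(raddf0 \pi_({quot (flat_part L)})).
  apply: le_lt_trans ltr01.
  by rewrite -(normr0 V) -[X in `|X|]subr0 quot_norm_le// rpred0.
- move=> i si; split=> //; have [_ _ vi] := s_lt i si.
  have d0 := delta_gt0 i si.
  apply: le_lt_trans (quot_norm_le (@normr_ge0 _ V) _ (rpred0 _)) _.
  by rewrite subr0 normrZ gtr0_norm ?invr_gt0// mulrC ltr_pdivrMr// mul1r.
move=> i j si sj ij.
have [ji|ji|/eqP] := ltngtP i j; last by rewrite (negPf ij).
  rewrite -opprB; apply: le_trans (ysep j i sj si ji) _.
  rewrite le_eqVlt; apply/orP; left; apply/eqP/esym.
  exact: (quot_normN (H := flat_part L) (@normr_ge0 _ V) (@normrN _ V)).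
exact: ysep.
Qed.

End PackingBounds.

(** * Spans and orthogonal projections *)

Section InnerProduct.
Variables (R : realType) (V : finNormedModType R) (ip : {dot V for idfun}).

(** Choose a finite list in A whose span has maximal dimension: adjoining another element of A
    cannot enlarge the span. *)
Lemma linear_span_seq (A : set V) : exists s : seq V,
  (forall x, x \in s -> A x) /\ forall v, linear_span A v <-> v \in span s.
Proof.
pose p k := `[< exists s : seq V,
  (forall x, x \in s -> A x) /\ \dim (span s) = k >].
have exp : exists k, p k by eexists; apply/asboolP; exists [::].
have p_le k : p k -> (k <= \dim {:V})%N.
  by move=> /asboolP[s [_ <-]]; exact: dimvS (subvf _).
have [k /asboolP[s [sA sk]] kmax] := ex_maxnP exp p_le.
exists s; split=> // v; split=> [[t [tA vt]]|vs]; last by exists s.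
have /subvP : (span t <= span s)%VS; last by apply.
apply/span_subvP => x xt.
have sxs : (span s <= span (x :: s))%VS by rewrite span_cons addvSr.
suff /eqP -> : span s == span (x :: s) by rewrite memv_span// mem_head.
rewrite eqEdim sxs sk; apply: kmax; apply/asboolP.
exists (x :: s); split=> // z.
by rewrite inE => /predU1P[->|/sA//]; exact: tA.
Qed.

Lemma dotC (v w : V) : ip v w = ip w v.
Proof. by rewrite (hermC ip) expr0 mul1r. Qed.

Lemma dotBl (u v w : V) : ip (u - v) w = ip u w - ip v w.
Proof. exact: linearBl. Qed.

Lemma dotDl (u v w : V) : ip (u + v) w = ip u w + ip v w.
Proof. exact: linearDl. Qed.

Lemma dotZl (c : R) (v w : V) : ip (c *: v) w = c * ip v w.
Proof. exact: linearZl_LR. Qed.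

(** Gram-Schmidt: x is replaced by its component x' orthogonal to [span s], and the projection of v
    gains its component along x'. *)
Lemma orth_proj_span_ex (s : seq V) (v : V) :
  exists2 p, p \in span s & forall x, x \in span s -> ip (v - p) x = 0.
Proof.
elim: s v => [|x s IHs] v.
  exists 0; first exact: mem0v.
  move=> x; rewrite span_nil memv0 => /eqP ->.
  by rewrite dotC; exact: linear0l.
have [q qs q_orth] := IHs x; have [p ps p_orth] := IHs v.
pose x' := x - q.
(* If x' = 0 the quotient is 0 by convention, and the correction c x' vanishes in any case. *)
pose c : R := ip v x' / ip x' x'.
have x'_orth z : z \in span s -> ip z x' = 0 by move=> /q_orth; rewrite dotC.
exists (p + c *: x').
have -> : p + c *: x' = c *: x + (p - c *: q) by rewrite scalerBr addrCA addrA.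
  rewrite span_cons memv_add ?memvZ ?memv_line//.
  by rewrite rpredB// rpredZ.
set w := v - _.
have ws z : z \in span s -> ip w z = 0.
  move=> zs; rewrite /w opprD addrA dotBl p_orth// (dotZl c x' z).
  by rewrite [ip x' z]dotC x'_orth// mulr0 subr0.
have wx' : ip w x' = 0.
  have [x'0|x'0] := eqVneq x' 0; first by rewrite x'0 dotC; exact: linear0l.
  rewrite /w opprD addrA dotBl dotBl (x'_orth p ps) (dotZl c x' x') /c.
  rewrite subr0 divfK ?subrr//.
  by rewrite gt_eqF// neq0_dnorm_gt0.
move=> y; rewrite span_cons => /memv_addP[_ /vlineP[k ->]] [z zs ->].
have wx : ip w x = 0.
  by rewrite dotC -(subrK q x) dotDl dotC wx' [ip q w]dotC (ws q qs) addr0.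
by rewrite dotC dotDl (dotZl k x w) [ip x w]dotC wx mulr0 add0r dotC ws.
Qed.

End InnerProduct.

(** * The bound by the packing number of the effective factor *)

Section EffectiveFactor.
Variables (R : realType) (V : finNormedModType R) (U : ultrametricZmodType R).
Variable L : zmodClosed (V * U)%type.
Variable ip : {dot V for idfun}.

(** If p is the projection of v onto W, then v - p is the required point of the orthogonal of W; so
    [xget] never takes its default. *)
Lemma orth_projP v : is_orth_proj L ip v (orth_proj L ip v).
Proof.
have [s [sW spanW]] := linear_span_seq [set v | v \in flat_part L].
have [p ps p_orth] := orth_proj_span_ex ip s v.
apply: (@xgetPex _ 0 [set q | is_orth_proj L ip v q]); exists (v - p); split.
  move=> w wW; apply: p_orth; apply/spanW; exists [:: w]; split.
    by move=> x; rewrite inE => /eqP ->.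
  by rewrite memv_span// mem_head.
rewrite subKr (coord_span (X := in_tuple s) ps).
apply: rpred_sum => i _; apply: rpredZ.
by apply: sW; exact: mem_nth.
Qed.

Hypothesis norm_ip : forall v : V, `|v| ^+ 2 = ip v v.

Lemma sqr_normD_orth v w : ip v w = 0 -> `|v + w| ^+ 2 = `|v| ^+ 2 + `|w| ^+ 2.
Proof.
move=> vw; have wv : ip w v = 0 by rewrite dotC.
by rewrite !norm_ip dotDl ![ip _ (v + w)]dotC !dotDl vw wv addr0 add0r.
Qed.

Lemma nn_count_le_effective (alpha : {quot L}) (N : nat) : (1 < N)%N ->
  (nn_count (@quot_dist R V U L) alpha N
     <= packing_number (fun v : V => `|v|%R)
          (effective_real_factor L ip) + 1)%N.
Proof.
move=> N1; have [s [delta [a [lam [s_uniq s_size s_lt s_ge]]]]] :=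
  record_lifts alpha N1.
rewrite addn1; apply: leq_trans s_size _; rewrite ltnS.
have [n nP] := subspace_packing_card V.
have [sE [_ spanE]] := linear_span_seq
  [set orth_proj L ip b.1 | b in [set b : V * U | b \in L]].
have [e eE f_orth] := orth_proj_span_ex ip sE (orth_proj L ip a.1).
set f := _ - e in f_orth.
pose v m : V := a.1 *+ m - (lam m).1.
(* [q m] is the projection of [v m] to the orthogonal of W, split into [x m], in E for record times,
   and m f, orthogonal to E. *)
pose x m : V := e *+ m - orth_proj L ip (lam m).1.
pose q m : V := x m + f *+ m.
have xE m : m \in s -> x m \in span sE.
  move=> /s_lt[_ lamL _]; rewrite rpredB ?rpredMn//.
  apply/spanE; exists [:: orth_proj L ip (lam m).1]; split.
    by move=> z; rewrite inE => /eqP ->; exists (lam m).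
  by rewrite memv_span// mem_head.
have qE m : q m = orth_proj L ip a.1 *+ m - orth_proj L ip (lam m).1.
  by rewrite /q /x addrAC -mulrnDl /f subrKC.
have vq m : v m - q m \in flat_part L.
  have -> : v m - q m =
      (a.1 - orth_proj L ip a.1) *+ m - ((lam m).1 - orth_proj L ip (lam m).1).
    rewrite qE /v mulrnBl !opprB addrACA [RHS]addrACA; congr (_ + _).
    exact: addrC.
  have pW u : u - orth_proj L ip u \in flat_part L by have [] := orth_projP u.
  by rewrite rpredB ?rpredMn.
have q_orth m w : w \in flat_part L -> ip (q m) w = 0.
  move=> wW; rewrite qE dotBl linearMnl /=.
  have [-> // _] := orth_projP a.1; have [-> // _] := orth_projP (lam m).1.
  by rewrite mul0rn subr0.
have q_le m : `|q m| <= `|v m|.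
  rewrite -(@ler_pXn2r _ 2) ?nnegrE// -[v m](subrKC (q m)).
  by rewrite (sqr_normD_orth (q_orth m _ (vq m))) lerDl sqr_ge0.
have sqr_normDf z k : z \in span sE ->
    `|z + f *+ k| ^+ 2 = `|z| ^+ 2 + (`|f| *+ k) ^+ 2.
  move=> zE; rewrite sqr_normD_orth ?normrMn//.
  by rewrite linearMnr /= dotC f_orth// mul0rn.
(* The separation modulo W is applied with w the W-component of [v i - v j]. *)
have q_sep i j : i \in s -> j \in s -> (j < i)%N -> delta <= `|q i - q j|.
  move=> si sj ij.
  have subACA (u1 u2 u3 u4 : V) : u1 - u2 - (u3 - u4) = u1 - u3 - (u2 - u4).
    by rewrite [in LHS]opprD addrACA -opprD.
  have -> : q i - q j = v i - v j - ((v i - q i) - (v j - q j)).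
    by rewrite (subACA (v i) (q i)) subKr.
  by apply: s_ge => //; exact: rpredB.
have delta_gt0 m : m \in s -> 0 < delta.
  by move=> /s_lt[_ _]; apply: le_lt_trans; exact: normr_ge0.
(* Record times exceed N/2 and their differences do not, so N/2 copies of f are the right amount to
   remove from both bounds. [Num.sqrt] is 0 on negative arguments, but a record makes this one
   positive by [x_sqr_lt]. *)
pose eta := Num.sqrt (delta ^+ 2 - (`|f| *+ N./2) ^+ 2).
have fM_le k k' : (k <= k')%N -> (`|f| *+ k) ^+ 2 <= (`|f| *+ k') ^+ 2.
  by move=> kk'; rewrite lerXn2r ?nnegrE ?mulrn_wge0// ler_wpMn2l.
have x_sqr_lt m : m \in s -> `|x m| ^+ 2 < delta ^+ 2 - (`|f| *+ N./2) ^+ 2.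
  move=> ms; have [/andP[Mm _] _ v_lt] := s_lt m ms.
  rewrite ltrBrDr; apply: le_lt_trans (lerD (lexx _) (fM_le _ _ (ltnW Mm))) _.
  rewrite -sqr_normDf ?xE// ltr_pXn2r ?nnegrE ?(ltW (delta_gt0 m ms))//.
  exact: le_lt_trans (q_le m) v_lt.
have eta_gt0 m : m \in s -> 0 < eta.
  by move=> /x_sqr_lt; rewrite sqrtr_gt0; apply: le_lt_trans; exact: sqr_ge0.
have x_lt m : m \in s -> `|x m| < eta.
  move=> ms; rewrite -(@ltr_pXn2r _ 2) ?nnegrE ?sqrtr_ge0//.
  by rewrite sqr_sqrtr ?x_sqr_lt// ltW// -sqrtr_gt0 (eta_gt0 m).
have x_sep i j : i \in s -> j \in s -> (j < i)%N -> eta <= `|x i - x j|.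
  move=> si sj ij; rewrite -[leRHS]ger0_norm// -sqrtr_sqr ler_sqrt ?sqr_ge0//.
  rewrite lerBlDr.
  have [/andP[_ iN] _ _] := s_lt i si; have [/andP[Mj _] _ _] := s_lt j sj.
  apply: le_trans (lerD (lexx _) (fM_le (i - j)%N _ _)); last by lia.
  rewrite -(sqr_normDf _ _ (rpredB (xE i si) (xE j sj))).
  have -> : x i - x j + f *+ (i - j) = q i - q j.
    by rewrite /q mulrnBr 1?ltnW// addrACA -opprD.
  by rewrite ler_pXn2r ?nnegrE ?(ltW (delta_gt0 i si))//; exact: q_sep.
apply: (size_le_packing_number (y := fun m => eta^-1 *: x m) (nP _)) => //.
- by rewrite normr0 ltr01.
- move=> i si; split; first by apply/spanE; rewrite memvZ// xE.
  rewrite normrZ gtr0_norm ?invr_gt0 ?(eta_gt0 i)// mulrC.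
  by rewrite ltr_pdivrMr ?mul1r ?x_lt// (eta_gt0 i).
have y_sep i j : i \in s -> j \in s -> (j < i)%N ->
    1 <= `|eta^-1 *: x i - eta^-1 *: x j|.
  move=> si sj ij; rewrite -scalerBr normrZ gtr0_norm ?invr_gt0 ?(eta_gt0 i)//.
  by rewrite mulrC ler_pdivlMr ?mul1r ?x_sep// (eta_gt0 i).
move=> i j si sj ij.
have [ji|ji|/eqP] := ltngtP i j; last by rewrite (negPf ij).
  by rewrite distrC; exact: y_sep.
exact: y_sep.
Qed.

End EffectiveFactor.

Theorem theorem1 (R : realType) (d : nat) (V : finNormedModType R)
    (U : ultrametricZmodType R) (L : zmodClosed (V * U)%type)
    (d_ge1 : (1 <= d)%N) (dimV : \dim {: V} = d)
    (closedL : closed ([set a | a \in L] : set (prod_space V U))) :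
  (forall (alpha : {quot L}) (N : nat), (2 <= N)%N ->
     (nn_count (@quot_dist R V U L) alpha N
        <= packing_number (@reduced_norm R V U L) setT + 1)%N) /\
  (forall ip : {dot V for idfun}, (forall v : V, `|v| ^+ 2 = ip v v) ->
     forall (alpha : {quot L}) (N : nat), (2 <= N)%N ->
     (nn_count (@quot_dist R V U L) alpha N
        <= packing_number (fun v : V => `|v|%R)
             (effective_real_factor L ip) + 1)%N).
Proof.
split=> [alpha N N_ge2|ip norm_ip alpha N N_ge2].
  exact: nn_count_le_reduced.
exact: nn_count_le_effective.
Qed.
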